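(* Assume the leakage condition and that $R_0$ is trace class, and fix $x\in H$ with $\langle x,R_0x\rangle>0$. For each $\omega\in\Omega$ and $k\ge1$, let $\{u_{k,r}(\omega)\}_{r\in\mathcal R_k(\omega)}$ be an (at most countable) orthonormal family and $\lambda_{k,r}(\omega)\ge0$ such that $\Delta_k(\omega)=\sum_{r}\lambda_{k,r}(\omega)\langle\cdot,u_{k,r}(\omega)\rangle u_{k,r}(\omega)$ in the strong operator topology (a spectral decomposition of the positive compact operator $\Delta_k(\omega)$), and set $\varphi_{k,r}(\omega)=\lambda_{k,r}(\omega)^{1/2}u_{k,r}(\omega)$. Then there is a set $\Omega_x\subseteq\Omega$ with $\nu_x(\Omega_x)=1$ such that for every $\omega\in\Omega_x$, $\langle x,R_0x\rangle=\sum_{k=1}^\infty A_k(\omega)=\sum_{k=1}^\infty\sum_{r\in\mathcal R_k(\omega)}|\langle x,\varphi_{k,r}(\omega)\rangle|^2$, the double series converging monotonically.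
   Context: Let $H$ be a separable complex Hilbert space, $m\ge2$, $P_1,\dots,P_m$ orthogonal projections on $H$, $R_0\in B(H)_+$, and $H_0=\overline{\mathrm{ran}}(R_0^{1/2})$. Let $\mathcal A=\{1,\dots,m\}$, $\mathcal W$ the set of finite words over $\mathcal A$ (including the empty word $\emptyset$); for nonempty $w=j_1\cdots j_n$, $w^-=j_1\cdots j_{n-1}$, and $wj$ is concatenation. WR energy tree: $R_\emptyset=R_0$, and for $w=j_1\cdots j_n$, $n\ge1$, $R_w=R_{w^-}^{1/2}(I-P_{j_n})R_{w^-}^{1/2}$, $D_w=R_{w^-}^{1/2}P_{j_n}R_{w^-}^{1/2}$. $\Omega=\mathcal A^{\mathbb N}$; for $\omega=(j_1,j_2,\dots)$, $\omega|_n=j_1\cdots j_n$, $\omega|_0=\emptyset$; cylinders $[w]=\{\omega:\omega|_{|w|}=w\}$. $\Delta_k(\omega)=D_{\omega|_k}=R_{\omega|_{k-1}}^{1/2}P_{j_k}R_{\omega|_{k-1}}^{1/2}$ and $A_k(\omega)=\langle x,\Delta_k(\omega)x\rangle$. Energy-biased path measure: with $x$ fixed, $a_{wj}=\langle x,D_{wj}x\rangle$, a fixed probability vector $q$ on $\mathcal A$, $p_x(j\mid w)=a_{wj}/\sum_k a_{wk}$ if $\sum_ka_{wk}>0$ and $p_x(j\mid w)=q_j$ otherwise; $\nu_x$ is the unique Borel probability measure on $\Omega$ with $\nu_x([j_1\cdots j_n])=\prod_{i=1}^n p_x(j_i\mid j_1\cdots j_{i-1})$. Leakage condition: there is $\alpha>0$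 with $\langle v,(\sum_{j=1}^mP_j)v\rangle\ge\alpha\|v\|^2$ for all $v\in H_0$. *)

(* Defs.v *)
From HB Require Import structures.
From mathcomp Require Import all_boot all_order all_algebra.
From mathcomp Require Import complex.
From mathcomp Require Import all_classical all_reals all_analysis.
Set Implicit Arguments.
Unset Strict Implicit.
Unset Printing Implicit Defensive.
Import Order.TTheory GRing.Theory Num.Theory.
Import numFieldNormedType.Exports.
Local Open Scope classical_set_scope.
Local Open Scope ring_scope.

(* Complex Hilbert spaces, given by a C-vector space H (C = R[i]) and  *)
(* an inner product ip, linear in the FIRST argument and conjugate-    *)
(* linear in the second (so that <.,u>u is a linear operator).         *)
Section Hilbert.
Variables (R : realType) (H : lmodType R[i]) (ip : H -> H -> R[i]).

Definition inner_product_axioms : Prop :=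
  [/\ (forall (a : R[i]) (u v w : H), ip (a *: u + v) w = a * ip u w + ip v w),
      (forall u v : H, ip v u = conjc (ip u v)),
      (forall v : H, 0 <= ip v v) &
      (forall v : H, ip v v = 0 -> v = 0)].

Definition hnorm (v : H) : R := Num.sqrt (complex.Re (ip v v)).

Definition hcvg (s : nat -> H) (v : H) : Prop :=
  (fun n => hnorm (s n - v)) @ \oo --> (0 : R).

Definition hcauchy (s : nat -> H) : Prop :=
  forall e : R, 0 < e -> exists N : nat,
    forall p q : nat, (N <= p)%N -> (N <= q)%N -> hnorm (s p - s q) < e.

Definition hcomplete : Prop := forall s, hcauchy s -> exists v, hcvg s v.

Definition hseparable : Prop :=
  exists d : nat -> H, forall (v : H) (e : R), 0 < e -> exists k, hnorm (v - d k) < e.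

Definition separable_hilbert : Prop :=
  [/\ inner_product_axioms, hcomplete & hseparable].

Definition bounded_op (T : H -> H) : Prop :=
  (forall (a : R[i]) (u v : H), T (a *: u + v) = a *: T u + T v) /\
  exists M : R, forall v, hnorm (T v) <= M * hnorm v.

Definition orth_proj (P : H -> H) : Prop :=
  [/\ bounded_op P, (forall v, P (P v) = P v) & (forall u v, ip (P u) v = ip u (P v))].

Definition positive_op (T : H -> H) : Prop :=
  bounded_op T /\ forall v, 0 <= ip v (T v).

Definition is_sqrt_op (S T : H -> H) : Prop :=
  positive_op S /\ forall v, S (S v) = T v.

(* T^{1/2}: the positive square root (unique when it exists; it exists for
   positive T).  The default branch is never used for positive T. *)
Definition opsqrt (T : H -> H) : H -> H :=
  match pselect (exists S, is_sqrt_op S T) with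
  | left e => proj1_sig (cid e)
  | right _ => T
  end.

Definition ortho_family (I : set nat) (e : nat -> H) : Prop :=
  forall i j, I i -> I j -> ip (e i) (e j) = (i == j)%:R.

Definition ortho_basis (I : set nat) (e : nat -> H) : Prop :=
  ortho_family I e /\ forall v, (forall i, I i -> ip v (e i) = 0) -> v = 0.

Definition trace_class_pos (T : H -> H) : Prop :=
  positive_op T /\
  exists (I : set nat) (e : nat -> H), ortho_basis I e /\
    cvgn (fun N => \sum_(0 <= i < N | i \in I) complex.Re (ip (e i) (T (e i)))).

Definition in_closure_range (S : H -> H) (v : H) : Prop :=
  forall e : R, 0 < e -> exists y, hnorm (v - S y) < e.

Variable m : nat.
Variables (P : 'I_m -> H -> H) (R0 : H -> H).

Definition leakage : Prop :=
  exists alpha : R, 0 < alpha /\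
    forall v, in_closure_range (opsqrt R0) v ->
      alpha * hnorm v ^+ 2 <= complex.Re (ip v (\sum_(j < m) P j v)).

(* WR energy tree.  Words are sequences j_1 ... j_n of letters in 'I_m;
   Rrev works on reversed words so that the last letter is peeled off. *)
Fixpoint Rrev (wr : seq 'I_m) : H -> H :=
  match wr with
  | [::] => R0
  | j :: wr' => let S := opsqrt (Rrev wr') in fun v => S (S v - P j (S v))
  end.

Definition Rw (w : seq 'I_m) : H -> H := Rrev (rev w).

Definition Dw (w : seq 'I_m) (j : 'I_m) : H -> H :=
  let S := opsqrt (Rw w) in fun v => S (P j (S v)).

(* omega|_k = j_1 ... j_k  (omega 0 = j_1) *)
Definition wprefix (om : nat -> 'I_m) (k : nat) : seq 'I_m := [seq om i | i <- iota 0 k].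

(* Delta_k(omega) = D_{omega|_k}, for k >= 1 *)
Definition DeltaOp (om : nat -> 'I_m) (k : nat) : H -> H :=
  Dw (wprefix om k.-1) (om k.-1).

Variable x : H.

Definition Ak (om : nat -> 'I_m) (k : nat) : R := complex.Re (ip x (DeltaOp om k x)).

Definition aw (w : seq 'I_m) (j : 'I_m) : R := complex.Re (ip x (Dw w j x)).

Variable q : 'I_m -> R.

Definition px (w : seq 'I_m) (j : 'I_m) : R :=
  let s := \sum_(k < m) aw w k in if 0 < s then aw w j / s else q j.

Fixpoint cprev (wr : seq 'I_m) : R :=
  match wr with
  | [::] => 1
  | j :: wr' => cprev wr' * px (rev wr') j
  end.

Definition cylprob (w : seq 'I_m) : R := cprev (rev w).

End Hilbert.

Definition cyl_set (m : nat) (w : seq 'I_m) : set (nat -> 'I_m) :=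
  [set om | wprefix om (size w) = w].

(* Omega = A^N with A = 'I_(n.+2)  (m = n + 2 >= 2 letters) *)
Definition Omega (n : nat) := nat -> 'I_n.+2.
HB.instance Definition _ n := gen_eqMixin (Omega n).
HB.instance Definition _ n := gen_choiceMixin (Omega n).
HB.instance Definition _ n := isPointed.Build (Omega n) (fun _ => ord0).

(* the cyl_set sets; they generate the Borel sigma-algebra of the
   product topology on Omega *)
Definition cylinders (n : nat) : set (set (Omega n)) := range (@cyl_set n.+2).

Definition OmegaM (n : nat) := g_sigma_algebraType (@cylinders n).

Definition cabs_c (R : realType) (z : R[i]) : R := complex.Re `|z|.

(* Main.v *)
Require Import Defs.
From HB Require Import structures.
From mathcomp Require Import all_boot all_order all_algebra.
From mathcomp Require Import complex.
From mathcomp Require Import all_classical all_reals all_analysis.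
From mathcomp Require Import ring lra.
Import Order.TTheory GRing.Theory Num.Theory.
Import numFieldNormedType.Exports.
Require Import Defs.
Set Implicit Arguments.
Unset Strict Implicit.
Unset Printing Implicit Defensive.
Local Open Scope classical_set_scope.
Local Open Scope ring_scope.
Local Open Scope complex_scope.

(* Let e_w = <x, R_w x>. Since R_w - R_{wj} = D_{wj}, the sum of the A_k along a
   path telescopes to e_0 - e_{w}, so the claim is that e vanishes along almost
   every path. The range of R_w^{1/2} stays in the closed range of R_0^{1/2}, so
   leakage gives sum_j a_{wj} >= alpha e_w; by Cauchy-Schwarz the size-biased
   choice of the letter then contracts the mean of e by 1 - alpha / m. Markov's
   inequality on finite unions of cylinders shows that, for every t > 0, the paths
   on which the nonincreasing e stays above t form a null set. The inner series
   over r sums to A_k by continuity of the inner product. The square roots are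
   obtained from the fixed-point iteration Y <- (I - T + Y^2) / 2, dominated in norm
   by the scalar iteration y <- (1 + y^2) / 2. *)

(** * Linear maps given as bare functions *)

Section LinearMaps.
Variables (K : nzRingType) (V : lmodType K) (T : V -> V).
Hypothesis linT : linear T.

Lemma linear_map0 : T 0 = 0.
Proof. by move: (linT (-1) 0 0); rewrite scaler0 addr0 scaleN1r addNr. Qed.

Lemma linear_mapD u v : T (u + v) = T u + T v.
Proof. by rewrite -[u in LHS]scale1r linT scale1r. Qed.

Lemma linear_mapZ a u : T (a *: u) = a *: T u.
Proof. by rewrite -[a *: u]addr0 linT linear_map0 addr0. Qed.

Lemma linear_mapB u v : T (u - v) = T u - T v.
Proof. by rewrite linear_mapD -scaleN1r linear_mapZ scaleN1r. Qed.

End LinearMaps.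

(** * The real inner product and positive operators *)

Section RealInnerProduct.
Variables (R : realType) (H : lmodType R[i]) (ip : H -> H -> R[i]).
Hypothesis ipP : inner_product_axioms ip.

Let ip_lin := let: And4 h _ _ _ := ipP in h.
Let ip_conj := let: And4 _ h _ _ := ipP in h.
Let ip_ge0 := let: And4 _ _ h _ := ipP in h.
Let ip_def := let: And4 _ _ _ h := ipP in h.

(** The real part keeps all estimates in R, within reach of [lra] and [nra]; it still gives the norm
    and separates vectors. *)
Definition rip (u v : H) : R := complex.Re (ip u v).

Lemma ReD (a b : R[i]) : complex.Re (a + b) = complex.Re a + complex.Re b.
Proof. by case: a; case: b. Qed.

Lemma ip0l v : ip 0 v = 0.
Proof. by have := ip_lin (-1) 0 0 v; rewrite scaler0 addr0 mulN1r addNr. Qed.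

Lemma ipDl u v w : ip (u + v) w = ip u w + ip v w.
Proof. by rewrite -[u in LHS]scale1r ip_lin mul1r. Qed.

Lemma ipZl a u v : ip (a *: u) v = a * ip u v.
Proof. by rewrite -[a *: u]addr0 ip_lin ip0l addr0. Qed.

Lemma ipDr u v w : ip w (u + v) = ip w u + ip w v.
Proof. by rewrite ip_conj ipDl rmorphD /= -!ip_conj. Qed.

Lemma ipZr a u v : ip v (a *: u) = a^* * ip v u.
Proof. by rewrite ip_conj ipZl rmorphM /= -ip_conj. Qed.

Lemma ripC u v : rip u v = rip v u.
Proof. by rewrite /rip ip_conj; case: (ip v u). Qed.

Lemma ripDl u v w : rip (u + v) w = rip u w + rip v w.
Proof. by rewrite /rip ipDl ReD. Qed.

Lemma ripDr u v w : rip w (u + v) = rip w u + rip w v.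
Proof. by rewrite ripC ripDl !(ripC w). Qed.

Lemma ripZl (c : R) u v : rip (c%:C *: u) v = c * rip u v.
Proof. by rewrite /rip ipZl; case: (ip u v) => a b /=; rewrite mul0r subr0. Qed.

Lemma ripZr (c : R) u v : rip v (c%:C *: u) = c * rip v u.
Proof. by rewrite ripC ripZl ripC. Qed.

Lemma ripNl u v : rip (- u) v = - rip u v.
Proof.
by rewrite -scaleN1r (_ : -1 = (-1)%:C) ?ripZl ?mulN1r // rmorphN1.
Qed.

Lemma ripNr u v : rip v (- u) = - rip v u.
Proof. by rewrite ripC ripNl ripC. Qed.

Lemma rip0l v : rip 0 v = 0.
Proof. by rewrite /rip ip0l. Qed.

Lemma rip0r v : rip v 0 = 0.
Proof. by rewrite ripC rip0l. Qed.

Definition ripE := (ripDl, ripDr, ripNl, ripNr, ripZl, ripZr, rip0l, rip0r).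

Lemma rip_sumr (I : Type) (r : seq I) (Q : pred I) (F : I -> H) v :
  rip v (\sum_(i <- r | Q i) F i) = \sum_(i <- r | Q i) rip v (F i).
Proof.
apply: (big_ind2 (fun a b => rip v a = b)) => [|a b c d <- <-|//].
  exact: rip0r.
exact: ripDr.
Qed.

Lemma rip_ge0 v : 0 <= rip v v.
Proof. by have := ip_ge0 v; rewrite lecE => /andP[]. Qed.

Lemma rip_eq0 v : rip v v = 0 -> v = 0.
Proof.
move=> h; apply: ip_def; move: (ger0_Im (ip_ge0 v)) h; rewrite /rip.
by case: (ip v v) => a b /= -> ->.
Qed.

Lemma rip_inj u v : (forall w, rip w u = rip w v) -> u = v.
Proof.
move=> h; apply/eqP; rewrite -subr_eq0; apply/eqP/rip_eq0.
by rewrite [X in X = _]ripDr ripNr h subrr.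
Qed.

Lemma hnorm_ge0 v : 0 <= hnorm ip v.
Proof. exact: sqrtr_ge0. Qed.

Lemma hnorm_sqr v : hnorm ip v ^+ 2 = rip v v.
Proof. by rewrite sqr_sqrtr ?rip_ge0. Qed.

Lemma hnorm_ler a v : 0 <= a -> (hnorm ip v <= a) = (rip v v <= a ^+ 2).
Proof. by move=> a0; rewrite -hnorm_sqr ler_sqr ?nnegrE ?hnorm_ge0. Qed.

Lemma hnormZ (c : R) v : hnorm ip (c%:C *: v) = `|c| * hnorm ip v.
Proof.
rewrite /hnorm -/(rip _ _) -/(rip v v) !ripE mulrA -expr2.
by rewrite sqrtrM ?sqr_ge0 // sqrtr_sqr.
Qed.

Lemma hnormN v : hnorm ip (- v) = hnorm ip v.
Proof. by rewrite /hnorm -!/(rip _ _) !ripE opprK. Qed.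

Lemma hnormB u v : hnorm ip (u - v) = hnorm ip (v - u).
Proof. by rewrite -hnormN opprB. Qed.

(** Cauchy-Schwarz: with a = |u| and b = |v| nonzero, expand 0 <= |b u - a v|^2 = 2ab (ab - Re <u,
    v>) and divide by 2ab. *)
Lemma rip_le_hnorm u v : rip u v <= hnorm ip u * hnorm ip v.
Proof.
have [a0 b0] := (hnorm_ge0 u, hnorm_ge0 v).
have := hnorm_sqr u; have := hnorm_sqr v.
set a := hnorm ip u in a0 *; set b := hnorm ip v in b0 *.
move=> hv hu.
have [a00|an0] := eqVneq a 0.
  by rewrite (_ : u = 0) ?rip0l ?mulr_ge0 //; apply/rip_eq0; rewrite -hu a00 expr0n.
have [b00|bn0] := eqVneq b 0.
  by rewrite (_ : v = 0) ?rip0r ?mulr_ge0 //; apply/rip_eq0; rewrite -hv b00 expr0n.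
have ab : 0 < a * b by rewrite mulr_gt0 // lt_def ?an0 ?bn0.
have := rip_ge0 (b%:C *: u - a%:C *: v).
rewrite !ripE -hu -hv (ripC v u) => h.
rewrite -(ler_pM2l ab); nra.
Qed.

Lemma rip_norm_le u v : `|rip u v| <= hnorm ip u * hnorm ip v.
Proof.
rewrite ler_norml rip_le_hnorm andbT lerNl -ripNl.
by rewrite -(hnormN u) rip_le_hnorm.
Qed.

Lemma hnormD u v : hnorm ip (u + v) <= hnorm ip u + hnorm ip v.
Proof.
rewrite hnorm_ler ?addr_ge0 ?hnorm_ge0 //.
rewrite !ripE (ripC v u) sqrrD !hnorm_sqr; have := rip_le_hnorm u v; lra.
Qed.

Lemma hnorm_trans u v w : hnorm ip (u - w) <= hnorm ip (u - v) + hnorm ip (v - w).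
Proof. by rewrite -(subrKA v u (- w)) hnormD. Qed.

Lemma hcvg_rip s v w : hcvg ip s v -> (fun n => rip w (s n)) @ \oo --> rip w v.
Proof.
move=> sv; apply/subr_cvg0.
apply/norm_cvg0P; apply: (squeeze_cvgr (f := cst 0) (h := fun n => hnorm ip w * hnorm ip (s n - v))).
- near=> k; rewrite normr_ge0 /= -ripNr -ripDr; exact: rip_norm_le.
- exact: cvg_cst.
- by rewrite -[X in _ --> X](mulr0 (hnorm ip w)); apply: cvgM => //; exact: cvg_cst.
Unshelve. all: by end_near. Qed.

Section PositiveOperators.
Variable T : H -> H.

Lemma positive_op_rip_ge0 : positive_op ip T -> forall v, 0 <= rip v (T v).
Proof. by move=> [_ h] v; have := h v; rewrite lecE => /andP[]. Qed.

(* Polarization: the imaginary part of <u + iv, T(u + iv)> vanishes. *)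
Lemma positive_op_sym : positive_op ip T -> forall u v, rip (T u) v = rip u (T v).
Proof.
move=> [[linT _] h] u v.
have := ger0_Im (h (u + 'i *: v)).
rewrite (linear_mapD linT) (linear_mapZ linT) !(ipDl, ipDr, ipZl, ipZr).
have := ger0_Im (h u); have := ger0_Im (h v).
rewrite (ripC (T u)) /rip.
case: (ip v (T v)) (ip u (T u)) (ip u (T v)) (ip v (T u)).
move=> a b [a' b'] [c d] [c' d'] /= -> ->; lra.
Qed.

(** Real symmetry applied to i v and v makes Im <v, T v> vanish, so positivity of the real part
    suffices. *)
Lemma sym_positive_op : bounded_op ip T ->
  (forall u v, rip (T u) v = rip u (T v)) -> (forall v, 0 <= rip v (T v)) ->
  positive_op ip T.
Proof.
move=> bT symT posT; split=> // v; rewrite lecE -/(rip v (T v)) posT andbT.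
have := symT ('i *: v) v; rewrite /rip (linear_mapZ bT.1) !ipZl (ip_conj v).
by case: (ip v (T v)) => a b /= h; apply/eqP; lra.
Qed.

Lemma bounded_op_pos : bounded_op ip T ->
  exists2 M, 0 < M & forall v, hnorm ip (T v) <= M * hnorm ip v.
Proof.
(* The bound in [bounded_op] may be zero or negative; |M| + 1 is a positive one. *)
move=> [_ [M hM]]; exists (`|M| + 1); first by rewrite ltr_wpDl.
move=> v; apply: le_trans (hM v) _; rewrite ler_wpM2r ?hnorm_ge0 //.
by rewrite (le_trans (ler_norm M)) // lerDl.
Qed.

(** Positivity of T at M v - T v gives 2M |Tv|^2 <= M^2 <v, Tv> + <Tv, T(Tv)>, and the last term is
    at most M |Tv|^2. *)
Lemma positive_op_sqr_le M : positive_op ip T -> 0 < M ->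
  (forall v, hnorm ip (T v) <= M * hnorm ip v) ->
  forall v, rip (T v) (T v) <= M * rip v (T v).
Proof.
move=> pT M0 hM v; have linT := pT.1.1.
have := positive_op_rip_ge0 pT (M%:C *: v - T v).
rewrite (linear_mapB linT) (linear_mapZ linT) !ripE.
rewrite -(positive_op_sym pT v (T v)) => h.
have h2 : rip (T v) (T (T v)) <= M * rip (T v) (T v).
  apply: le_trans (rip_le_hnorm _ _) _; rewrite -hnorm_sqr.
  have := hM (T v); have := hnorm_ge0 (T v); nra.
rewrite -(ler_pM2l M0); lra.
Qed.

End PositiveOperators.

Lemma bounded_op_comp S T : bounded_op ip S -> bounded_op ip T ->
  bounded_op ip (fun v => S (T v)).
Proof.
move=> bS bT; split=> [a u v|]; first by rewrite bT.1 bS.1.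
have [M M0 hM] := bounded_op_pos bS; have [N N0 hN] := bounded_op_pos bT.
exists (M * N) => v; apply: le_trans (hM _) _.
by rewrite -mulrA ler_pM2l.
Qed.

Lemma bounded_op_id : bounded_op ip id.
Proof. by split=> //; exists 1 => v; rewrite mul1r. Qed.

Lemma bounded_opB S T : bounded_op ip S -> bounded_op ip T ->
  bounded_op ip (fun v => S v - T v).
Proof.
move=> bS bT; split=> [a u v|].
  by rewrite bS.1 bT.1 scalerBr opprD addrACA.
have [M M0 hM] := bounded_op_pos bS; have [N N0 hN] := bounded_op_pos bT.
exists (M + N) => v; apply: le_trans (hnormD _ _) _.
by rewrite hnormN mulrDl lerD.
Qed.

Lemma bounded_opZ (c : R) T : bounded_op ip T -> bounded_op ip (fun v => c%:C *: T v).
Proof.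
move=> bT; split=> [a u v|]; first by rewrite bT.1 scalerDr !scalerA mulrC.
have [M M0 hM] := bounded_op_pos bT; exists (`|c| * M) => v.
by rewrite hnormZ -mulrA ler_wpM2l.
Qed.

End RealInnerProduct.

(** * The scalar majorant *)

Section ScalarIteration.
Variable R : realType.

Fixpoint scalar_iter (n : nat) : R :=
  if n is n'.+1 then 2^-1 * (1 + scalar_iter n' ^+ 2) else 0.

Lemma scalar_iter_itv n : 0 <= scalar_iter n <= 1.
Proof. by elim: n => [|n /andP[IH1 IH2]] /=; rewrite ?lexx ?ler01 //; apply/andP; split; nra. Qed.

Lemma scalar_iter_leS n : scalar_iter n <= scalar_iter n.+1.
Proof. by move=> /=; have /andP[h1 h2] := scalar_iter_itv n; nra. Qed.

Lemma scalar_iter_cvg : exists2 l, (forall n, scalar_iter n <= l) &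
  scalar_iter @ \oo --> l.
Proof.
have hom : nondecreasing_seq scalar_iter.
  by apply/nondecreasing_seqP => n; exact: scalar_iter_leS.
have cv : cvgn scalar_iter.
  apply: nondecreasing_is_cvgn => //; exists 1 => _ [n _ <-].
  by have /andP[] := scalar_iter_itv n.
by exists (limn scalar_iter) => // n; exact: nondecreasing_cvgn_le.
Qed.

End ScalarIteration.

(** * Existence of square roots of positive operators *)

Section SquareRoot.
Variables (R : realType) (H : lmodType R[i]) (ip : H -> H -> R[i]).
Hypothesis ipP : inner_product_axioms ip.

Section Iteration.
Variable A : H -> H.
Hypotheses (linA : linear A) (symA : forall u v, rip ip (A u) v = rip ip u (A v))
  (contrA : forall v, hnorm ip (A v) <= hnorm ip v).

Fixpoint sqrt_iter (n : nat) (v : H) : H :=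
  if n is n'.+1 then (2^-1)%:C *: (A v + sqrt_iter n' (sqrt_iter n' v)) else 0.

Lemma sqrt_iter_linear n : linear (sqrt_iter n).
Proof.
elim: n => [|n IH] a u v /=; first by rewrite scaler0 addr0.
by rewrite !IH linA addrACA -scalerDr [LHS]scalerDr !scalerA [a * _]mulrC.
Qed.

Lemma sqrt_iter_sym n u v : rip ip (sqrt_iter n u) v = rip ip u (sqrt_iter n v).
Proof.
elim: n u v => [|n IH] u v /=; first by rewrite (rip0l ipP) (rip0r ipP).
by rewrite (ripZl ipP) (ripZr ipP) (ripDl ipP) (ripDr ipP) symA !IH.
Qed.

Lemma sqrt_iter_bound n v :
  hnorm ip (sqrt_iter n v) <= scalar_iter R n * hnorm ip v.
Proof.
elim: n v => [|n IH] v /=.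
  by rewrite mul0r (hnorm_ler ipP) // (rip0l ipP) expr0n.
rewrite (hnormZ ipP) ger0_norm ?invr_ge0 // -mulrA ler_pM2l ?invr_gt0 //.
apply: le_trans (hnormD ipP _ _) _; rewrite mulrDl mul1r lerD // expr2 -mulrA.
apply: le_trans (IH _) _; rewrite ler_wpM2l //.
by have /andP[] := scalar_iter_itv R n.
Qed.

Lemma sqrt_iter_contr n v : hnorm ip (sqrt_iter n v) <= hnorm ip v.
Proof.
apply: le_trans (sqrt_iter_bound _ _) _.
rewrite ler_piMl ?hnorm_ge0 //.
by have /andP[] := scalar_iter_itv R n.
Qed.

(** Y'^2 - Y^2 = Y'(Y' - Y) + (Y' - Y)Y holds without commutation, and the scalar increments factor
    in the same way, so norms are bounded term by term. *)
Lemma sqrt_iter_incr n v : hnorm ip (sqrt_iter n.+1 v - sqrt_iter n v) <=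
  (scalar_iter R n.+1 - scalar_iter R n) * hnorm ip v.
Proof.
elim: n v => [|n IH] v.
  rewrite /= !subr0 addr0 (hnormZ ipP) expr0n addr0 ger0_norm ?invr_ge0 //.
  by rewrite mulr1 ler_pM2l ?invr_gt0.
have -> : sqrt_iter n.+2 v - sqrt_iter n.+1 v = (2^-1)%:C *:
    (sqrt_iter n.+1 (sqrt_iter n.+1 v - sqrt_iter n v) +
     (sqrt_iter n.+1 (sqrt_iter n v) - sqrt_iter n (sqrt_iter n v))).
  rewrite (linear_mapB (sqrt_iter_linear n.+1)) subrKA.
  rewrite [LHS]/= -scalerBr opprD addrACA subrr add0r.
  by [].
have -> : scalar_iter R n.+2 - scalar_iter R n.+1 = 2^-1 *
    (scalar_iter R n.+1 * (scalar_iter R n.+1 - scalar_iter R n) +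
     (scalar_iter R n.+1 - scalar_iter R n) * scalar_iter R n).
  have e k : scalar_iter R k.+1 = 2^-1 * (1 + scalar_iter R k ^+ 2) by [].
  by rewrite (e n.+1); have := e n; lra.
rewrite (hnormZ ipP) ger0_norm ?invr_ge0 // -mulrA ler_pM2l ?invr_gt0 //.
apply: le_trans (hnormD ipP _ _) _; rewrite mulrDl.
have y0 : 0 <= scalar_iter R n.+1 by have /andP[] := scalar_iter_itv R n.+1.
have d0 : 0 <= scalar_iter R n.+1 - scalar_iter R n.
  by rewrite subr_ge0 scalar_iter_leS.
apply: lerD; rewrite -mulrA.
  by apply: le_trans (sqrt_iter_bound _ _) _; rewrite ler_wpM2l.
by apply: le_trans (IH _) _; rewrite ler_wpM2l // sqrt_iter_bound.
Qed.

Lemma sqrt_iter_dist p k v : hnorm ip (sqrt_iter (p + k) v - sqrt_iter p v) <=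
  (scalar_iter R (p + k) - scalar_iter R p) * hnorm ip v.
Proof.
elim: k => [|k IH].
  by rewrite addn0 !subrr mul0r (hnorm_ler ipP) // (rip0l ipP) expr0n.
rewrite addnS; apply: le_trans (hnorm_trans ipP _ (sqrt_iter (p + k) v) _) _.
have := sqrt_iter_incr (p + k) v; move: IH; lra.
Qed.

Lemma sqrt_iter_cauchy v : hcauchy ip (sqrt_iter ^~ v).
Proof.
have [l lub cl] := scalar_iter_cvg R.
move=> e e0.
(* Adding 1 keeps the divisor positive when v = 0. *)
have v1 : 0 < hnorm ip v + 1 by rewrite ltr_wpDl // hnorm_ge0.
move/cvgrPdist_lt: cl => /(_ (e / (hnorm ip v + 1))) [|N _ HN].
  by rewrite divr_gt0.
suff key p k : (N <= p)%N -> hnorm ip (sqrt_iter (p + k) v - sqrt_iter p v) < e.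
  exists N => p q Np Nq; have [pq|/ltnW qp] := leqP p q.
    by rewrite (hnormB ipP) -(subnKC pq) key.
  by rewrite -(subnKC qp) key.
move=> Np; apply: le_lt_trans (sqrt_iter_dist _ _ _) _.
have := HN _ Np; rewrite /= ltr_pdivlMr // ger0_norm ?subr_ge0 //.
apply: le_lt_trans.
have := lub (p + k)%N; have := lub p; have := hnorm_ge0 ip v; nra.
Qed.

(** Linearity and the fixed-point equation pass to the pointwise limit weakly: they are paired with
    a vector w, where limits are limits of reals, and [rip_inj] removes w. *)
Lemma sqrt_iter_limit : hcomplete ip -> exists Y : H -> H,
  [/\ linear Y, (forall u v, rip ip (Y u) v = rip ip u (Y v)),
      (forall v, hnorm ip (Y v) <= hnorm ip v) &
      (forall v, Y v = (2^-1)%:C *: (A v + Y (Y v)))].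
Proof.
move=> hc; have [Y cY] := choice (fun v => hc _ (sqrt_iter_cauchy v)).
have wY w v : (fun n => rip ip w (sqrt_iter n v)) @ \oo --> rip ip w (Y v).
  exact: (hcvg_rip ipP (cY v)).
(* [rip] is only R-linear, so a complex scalar is moved onto w as its conjugate. *)
have wYZ w a v : (fun n => rip ip w (a *: sqrt_iter n v)) @ \oo --> rip ip w (a *: Y v).
  have e u : rip ip w (a *: u) = rip ip (a^* *: w) u.
    by rewrite /rip (ipZr ipP) (ipZl ipP).
  by rewrite e (_ : (fun _ => _) = (fun n => rip ip (a^* *: w) (sqrt_iter n v)))//; apply/funext.
(* |Y v|^2 = lim <Y v, Y_n v> <= |Y v| |v|; divide by |Y v|. *)
have contrY v : hnorm ip (Y v) <= hnorm ip v.
  have [->|Yn0] := eqVneq (hnorm ip (Y v)) 0; first exact: hnorm_ge0.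
  have Y0 : 0 < hnorm ip (Y v) by rewrite lt_def Yn0 hnorm_ge0.
  rewrite -(ler_pM2l Y0) -expr2 (hnorm_sqr ipP).
  rewrite -(cvg_lim _ (wY (Y v) v)) //; apply: limr_le.
    exact: cvgP (wY (Y v) v).
  near=> n; apply: le_trans (rip_le_hnorm ipP _ _) _.
  by rewrite ler_wpM2l ?hnorm_ge0 // sqrt_iter_contr.
exists Y; split => //.
- move=> a u v; apply: (rip_inj ipP) => w.
  have := wY w (a *: u + v).
  under eq_fun do rewrite sqrt_iter_linear (ripDr ipP).
  move=> h; apply: (cvg_unique _ h) => //.
  by rewrite (ripDr ipP); apply: cvgD.
- move=> u v; rewrite (ripC ipP).
  have := wY u v; under eq_fun do rewrite -sqrt_iter_sym (ripC ipP).
  by move=> h; apply: (cvg_unique _ (wY v u) h).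
- move=> v; apply: (rip_inj ipP) => w.
  have h : (fun n => rip ip w (sqrt_iter n.+1 v)) @ \oo --> rip ip w (Y v).
    by have := wY w v; rewrite -(cvg_shiftS (fun n => rip ip w (sqrt_iter n v))).
  (* In this splitting of Y_n (Y_n v), the first term tends to 0 because the Y_n are contractions,
     and the second to <w, Y (Y v)>. *)
  have e n : rip ip w (sqrt_iter n (sqrt_iter n v)) =
      rip ip w (sqrt_iter n (sqrt_iter n v - Y v)) + rip ip w (sqrt_iter n (Y v)).
    by rewrite (linear_mapB (sqrt_iter_linear n)) -(ripDr ipP) subrK.
  have h0 : (fun n => rip ip w (sqrt_iter n (sqrt_iter n v - Y v))) @ \oo --> (0 : R).
    apply/norm_cvg0P; apply: (squeeze_cvgr (f := cst 0)
      (h := fun n => hnorm ip w * hnorm ip (sqrt_iter n v - Y v))).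
    + near=> n; rewrite normr_ge0 /=.
      apply: le_trans (rip_norm_le ipP _ _) _.
      by rewrite ler_wpM2l ?hnorm_ge0 // sqrt_iter_contr.
    + exact: cvg_cst.
    + rewrite -[X in _ --> X](mulr0 (hnorm ip w)).
      by apply: cvgM => //; [exact: cvg_cst|exact: cY].
  have hYY : (fun n => rip ip w (sqrt_iter n (sqrt_iter n v))) @ \oo -->
      rip ip w (Y (Y v)).
    under eq_fun do rewrite e.
    by rewrite -[rip ip w (Y (Y v))]add0r; apply: cvgD h0 (wY _ _).
  suff h2 : (fun n => rip ip w (sqrt_iter n.+1 v)) @ \oo -->
      rip ip w ((2^-1)%:C *: (A v + Y (Y v))).
    exact: (cvg_unique _ h h2).
  under eq_fun do rewrite /= (ripZr ipP) (ripDr ipP).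
  rewrite (ripZr ipP) (ripDr ipP); apply: cvgM; first exact: cvg_cst.
  by apply: cvgD hYY; exact: cvg_cst.
Unshelve. all: by end_near. Qed.

End Iteration.

(* With A = I - T, the fixed point Y of Y = (A + Y^2) / 2 satisfies (I - Y)^2 = T. *)
Lemma contraction_sqrt T : hcomplete ip -> positive_op ip T ->
  (forall v, hnorm ip (T v) <= hnorm ip v) -> exists S, is_sqrt_op ip S T.
Proof.
move=> hc pT cT; have symT := positive_op_sym ipP pT.
have [linT bT] := pT.1.
have bA := bounded_opB ipP (bounded_op_id ip) pT.1.
have [|v|Y [linY symY cY eY]] := sqrt_iter_limit bA.1 _ _ hc.
- by move=> u v; rewrite (ripDl ipP) (ripDr ipP) (ripNl ipP) (ripNr ipP) symT.
(* |v - Tv|^2 = |v|^2 - 2 <v, Tv> + |Tv|^2 <= |v|^2, since |Tv|^2 <= <v, Tv> and <v, Tv> >= 0. *)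
- rewrite (hnorm_ler ipP) ?hnorm_ge0 // (hnorm_sqr ipP).
  have := positive_op_sqr_le ipP pT ltr01 (fun v => _).
  move=> /(_ _ v); rewrite mul1r => h.
  rewrite !(ripE ipP) (ripC ipP (T v) v).
  have := positive_op_rip_ge0 pT v.
  have : rip ip (T v) (T v) <= rip ip v (T v) by apply: h => w; rewrite mul1r.
  lra.
have bY : bounded_op ip Y by split=> //; exists 1 => v; rewrite mul1r.
exists (fun v => v - Y v); split=> [|v].
  apply: (sym_positive_op ipP) => [|u v|v].
  - exact: (bounded_opB ipP (bounded_op_id ip) bY).
  - by rewrite (ripDl ipP) (ripDr ipP) (ripNl ipP) (ripNr ipP) symY.
  rewrite !(ripE ipP) subr_ge0; apply: le_trans (rip_le_hnorm ipP _ _) _.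
  by rewrite -(hnorm_sqr ipP) expr2 ler_wpM2l ?hnorm_ge0.
have -> : T v = v - (v - T v) by rewrite subKr.
have e2 : v - T v = Y v + Y v - Y (Y v).
  have -> : Y v + Y v = (2%:R : R)%:C *: Y v.
    by rewrite rmorph_nat scaler_nat mulr2n.
  rewrite [in RHS](eY v) [in RHS]scalerA -rmorphM divff ?pnatr_eq0 // scale1r.
  by rewrite -eY addrK.
rewrite e2 (linear_mapB linY) !opprD !opprK !addrA //.
Qed.

(** For a norm bound M > 0, T / M is a contraction; sqrt M times its square root serves for T. *)
Lemma sqrt_op_exists T : hcomplete ip -> positive_op ip T ->
  exists S, is_sqrt_op ip S T.
Proof.
move=> hc pT; have [M M0 hM] := bounded_op_pos pT.1.
have M0' : 0 <= M^-1 by rewrite invr_ge0 ltW.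
have s0 := sqrtr_ge0 M.
have symT := positive_op_sym ipP pT.
have pT' : positive_op ip (fun v => (M^-1)%:C *: T v).
  apply: (sym_positive_op ipP) => [|u v|v].
  - exact: (bounded_opZ ipP _ pT.1).
  - by rewrite (ripZl ipP) (ripZr ipP) symT.
  - by rewrite (ripZr ipP) mulr_ge0 // (positive_op_rip_ge0 pT).
have [|S [pS eS]] := contraction_sqrt hc pT'.
  by move=> v; rewrite (hnormZ ipP) ger0_norm // ler_pdivrMl.
have symS := positive_op_sym ipP pS.
exists (fun v => (Num.sqrt M)%:C *: S v); split=> [|v].
  apply: (sym_positive_op ipP) => [|u v|v].
  - exact: (bounded_opZ ipP _ pS.1).
  - by rewrite (ripZl ipP) (ripZr ipP) symS.
  - by rewrite (ripZr ipP) mulr_ge0 // (positive_op_rip_ge0 pS).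
rewrite (linear_mapZ pS.1.1) eS !scalerA -!rmorphM -expr2 sqr_sqrtr ?ltW //.
by rewrite divff ?gt_eqF // scale1r.
Qed.

Lemma opsqrtP T : hcomplete ip -> positive_op ip T -> is_sqrt_op ip (opsqrt ip T) T.
Proof.
move=> hc pT; rewrite /opsqrt; case: pselect => [h|[]].
  exact: (proj2_sig (cid h)).
exact: sqrt_op_exists.
Qed.

(* Richardson iteration z_{n+1} = z_n - S z_n / M from z_0 = y: each step loses
   at least |S z_n|^2 / M^2 from |z_n|^2, so S z_n gets arbitrarily small, while
   y - z_n stays in the range of S. *)
Lemma range_op_approx S : positive_op ip S -> forall y e, 0 < e ->
  exists z, hnorm ip (S y - S (S z)) < e.
Proof.
move=> pS y e e0; have linS := pS.1.1; have [M M0 hM] := bounded_op_pos pS.1.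
pose B v := v - (M^-1)%:C *: S v; pose z n := iter n B y.
have zP n : exists g, z n = y - S g.
  elim: n => [|n [g hg]]; first by exists 0; rewrite (linear_map0 linS) subr0.
  exists (g + (M^-1)%:C *: z n).
  rewrite (linear_mapD linS) (linear_mapZ linS) opprD addrA -hg //.
(* |B v|^2 = |v|^2 - (2 / M) <v, S v> + |S v|^2 / M^2, and |S v|^2 <= M <v, S v>. *)
have step v : rip ip (S v) (S v) <= M ^+ 2 * (rip ip v v - rip ip (B v) (B v)).
  have h := positive_op_sqr_le ipP pS M0 hM v.
  rewrite /B !(ripE ipP) (ripC ipP (S v) v).
  rewrite [X in _ <= X](_ : _ = 2 * M * rip ip v (S v) - rip ip (S v) (S v)); last first.
    by field; rewrite gt_eqF.
  lra.
(* Otherwise M^2 |z_n|^2 drops by at least e^2 at each step and is negative once n exceeds M^2 |y|^2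
   / e^2. *)
have [n hn] : exists n, rip ip (S (z n)) (S (z n)) < e ^+ 2.
  apply: contrapT => /forallNP h.
  have dec n : M ^+ 2 * rip ip (z n) (z n) <= M ^+ 2 * rip ip y y - n%:R * e ^+ 2.
    elim: n => [|n IH]; first by rewrite mul0r subr0.
    have /negP := h n; rewrite -leNgt => hn; have := step (z n).
    rewrite -/(z n.+1) -natr1; move: IH; rewrite /z /=; lra.
  have e2 : 0 < e ^+ 2 by rewrite exprn_gt0.
  have := dec (Num.truncn (M ^+ 2 * rip ip y y / e ^+ 2)).+1.
  have := truncnS_gt (M ^+ 2 * rip ip y y / e ^+ 2).
  rewrite ltr_pdivrMr // => h1 h2.
  have : 0 <= M ^+ 2 * rip ip (z (Num.truncn (M ^+ 2 * rip ip y y / e ^+ 2)).+1)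
     (z (Num.truncn (M ^+ 2 * rip ip y y / e ^+ 2)).+1).
    by rewrite mulr_ge0 ?sqr_ge0 // (rip_ge0 ipP).
  lra.
have [g hg] := zP n; exists g.
rewrite -(linear_mapB linS) -hg -(@ltr_pXn2r _ 2) ?nnegrE ?hnorm_ge0 ?ltW //.
by rewrite (hnorm_sqr ipP).
Qed.

End SquareRoot.

(** * Energy along the tree *)

Lemma wprefixS m (om : nat -> 'I_m) k :
  wprefix om k.+1 = rcons (wprefix om k) (om k).
Proof. by rewrite /wprefix -addn1 iotaD map_cat cats1 add0n. Qed.

Section EnergyTree.
Variables (R : realType) (H : lmodType R[i]) (ip : H -> H -> R[i]).
Variables (m : nat) (P : 'I_m -> H -> H) (R0 : H -> H) (x : H).
Hypotheses (ipP : inner_product_axioms ip) (hc : hcomplete ip).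
Hypotheses (projP : forall j, orth_proj ip (P j)) (posR0 : positive_op ip R0).

Lemma orth_proj_rip j v : rip ip v (P j v) = rip ip (P j v) (P j v).
Proof.
have [_ idem sym] := projP j.
by rewrite /rip sym idem.
Qed.

(** With S = R_w^{1/2}, <v, R_wj v> = |S v - P_j S v|^2. Positivity at each word makes the next
    [opsqrt] a genuine square root. *)
Lemma Rrev_positive wr : positive_op ip (Rrev ip P R0 wr).
Proof.
elim: wr => [|j wr IH] //=.
have [pS _] := opsqrtP ipP hc IH; set S := opsqrt _ _ in pS *.
have [bP _ symP] := projP j; have symS := positive_op_sym ipP pS.
apply: (sym_positive_op ipP) => [|u v|v].
- apply: bounded_op_comp => //; first exact: pS.1.
  by apply: (bounded_opB ipP pS.1); apply: bounded_op_comp => //; exact: pS.1.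
- by rewrite symS -[RHS]symS !(ripE ipP) [in LHS]/rip symP.
- rewrite -symS !(ripE ipP) orth_proj_rip.
  have := rip_ge0 ipP (S v - P j (S v)).
  by rewrite !(ripE ipP) (ripC ipP (P j _) (S v)) orth_proj_rip; lra.
Qed.

Lemma Rw_sqrt w : is_sqrt_op ip (opsqrt ip (Rw ip P R0 w)) (Rw ip P R0 w).
Proof. exact: opsqrtP (Rrev_positive _). Qed.

Lemma Rw_rcons w j v : Rw ip P R0 (rcons w j) v = Rw ip P R0 w v - Dw ip P R0 w j v.
Proof.
have [pS sqS] := Rw_sqrt w.
by rewrite /Dw -sqS -(linear_mapB pS.1.1) /Rw rev_rcons.
Qed.

(** Induction on the word: with S = R_wj^{1/2}, S v is close to some S (S z) = R_wj z, which lies in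
    the range of R_w^{1/2}, hence in the closed range of R_0^{1/2}. *)
Lemma opsqrt_Rrev_range wr v :
  in_closure_range ip (opsqrt ip R0) (opsqrt ip (Rrev ip P R0 wr) v).
Proof.
elim: wr v => [|j wr IH] v e e0 /=.
  by exists v; rewrite subrr (le_lt_trans _ e0) // (hnorm_ler ipP) // (rip0l ipP) expr0n.
have e2 : 0 < e / 2 by rewrite divr_gt0.
have [pS sqS] := opsqrtP ipP hc (Rrev_positive (j :: wr)).
have [z hz] := range_op_approx ipP pS v e2; rewrite sqS in hz.
have [y hy] := IH (opsqrt ip (Rrev ip P R0 wr) z - P j (opsqrt ip (Rrev ip P R0 wr) z)) _ e2.
exists y; apply: le_lt_trans (hnorm_trans ipP _ (Rrev ip P R0 (j :: wr) z) _) _.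
by rewrite [ltRHS](splitr e); apply: ltrD hz hy.
Qed.

Definition energy (w : seq 'I_m) : R := rip ip x (Rw ip P R0 w x).

Lemma energy_norm w : energy w = hnorm ip (opsqrt ip (Rw ip P R0 w) x) ^+ 2.
Proof.
have [pS sqS] := Rw_sqrt w.
by rewrite /energy -sqS -(positive_op_sym ipP pS) (hnorm_sqr ipP).
Qed.

Lemma energy_ge0 w : 0 <= energy w.
Proof. by rewrite energy_norm sqr_ge0. Qed.

Lemma awE w j : aw ip P R0 x w j =
  rip ip (opsqrt ip (Rw ip P R0 w) x) (P j (opsqrt ip (Rw ip P R0 w) x)).
Proof.
have [pS _] := Rw_sqrt w.
by rewrite (positive_op_sym ipP pS).
Qed.

Lemma aw_ge0 w j : 0 <= aw ip P R0 x w j.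
Proof. by rewrite awE orth_proj_rip (rip_ge0 ipP). Qed.

Lemma energy_rcons w j : energy (rcons w j) = energy w - aw ip P R0 x w j.
Proof. by rewrite /energy Rw_rcons (ripDr ipP) (ripNr ipP). Qed.

(** The range 1 <= k < N has N - 1 terms, so the path is read up to length [N.-1]; at N = 0 both
    sides vanish. *)
Lemma sum_Ak om N : \sum_(1 <= k < N) Ak ip P R0 x om k =
  energy [::] - energy (wprefix om N.-1).
Proof.
case: N => [|N]; first by rewrite big_geq // subrr.
elim: N => [|N IH]; first by rewrite big_geq // subrr.
rewrite big_nat_recr //= IH wprefixS energy_rcons /Ak /DeltaOp /=.
rewrite -/(aw _ _ _ _ _ _); ring.
Qed.

(** Leakage is applied to v = R_w^{1/2} x, for which |v|^2 is the energy of w and <v, P_j v> is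
    a_wj. *)
Lemma leakage_energy : leakage ip P R0 -> exists2 alpha, 0 < alpha &
  forall w, alpha * energy w <= \sum_(j < m) aw ip P R0 x w j.
Proof.
move=> [alpha [a0 h]]; exists alpha => // w.
rewrite energy_norm; apply: le_trans (h _ (opsqrt_Rrev_range _ _)) _.
rewrite -/(rip ip _ _) (rip_sumr ipP); under [leRHS]eq_bigr do rewrite awE.
exact: lexx.
Qed.

End EnergyTree.

(** * Contraction of the mean energy by one letter *)

Lemma sum_sqr_ge (R : realFieldType) n (a : 'I_n.+1 -> R) :
  (\sum_j a j) ^+ 2 / n.+1%:R <= \sum_j a j ^+ 2.
Proof.
set s := \sum_j a j.
(* Expand the sum of squared deviations from the mean. *)
have : 0 <= \sum_j (a j - s / n.+1%:R) ^+ 2 by apply: sumr_ge0 => j _; exact: sqr_ge0.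
under eq_bigr do rewrite sqrrB.
rewrite big_split sumrB /= sumr_const card_ord -(mulr_natl (_ ^+ 2)) sumrMnl -mulr_suml -/s.
have n0 : n.+1%:R != 0 :> R by rewrite pnatr_eq0.
suff -> : n.+1%:R * (s / n.+1%:R) ^+ 2 = s ^+ 2 / n.+1%:R.
  have -> : s * (s / n.+1%:R) *+ 2 = 2 * (s ^+ 2 / n.+1%:R).
    by rewrite mulrA -expr2 mulr_natl.
  set t := _ / _; set b := \sum_j _; lra.
by field; rewrite addrC natr1.
Qed.

(* Size-biased selection of a loss a_j is at least as good as the mean loss. *)
Lemma biased_contraction (R : realFieldType) n (a q : 'I_n.+1 -> R) (E alpha : R) :
  (forall j, 0 <= a j) -> 0 <= E -> 0 < alpha ->
  alpha * E <= \sum_j a j ->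
  \sum_j (if 0 < \sum_k a k then a j / \sum_k a k else q j) * (E - a j) <=
  (1 - alpha / n.+1%:R) * E.
Proof.
move=> a0 E0 al0; set s := \sum_j a j => hs.
have n0 : 0 < n.+1%:R :> R by rewrite ltr0n.
have s0 : 0 <= s by apply: sumr_ge0.
case: ltP => [sp|s_le0].
  have -> : \sum_j a j / s * (E - a j) = E - s^-1 * \sum_j a j ^+ 2.
    transitivity (\sum_j (s^-1 * E * a j - s^-1 * a j ^+ 2)).
      by apply: eq_bigr => j _; ring.
    by rewrite sumrB -!mulr_sumr -/s; field; rewrite gt_eqF.
  have h : s / n.+1%:R <= s^-1 * \sum_j a j ^+ 2.
    rewrite -(ler_pM2l sp) [leRHS]mulrA divff ?gt_eqF // mul1r mulrA -expr2.
    exact: sum_sqr_ge.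
  rewrite mulrBl mul1r lerD2l lerN2; apply: le_trans h.
  by rewrite mulrAC ler_pM2r ?invr_gt0.
(* When s = 0, leakage forces E = 0 and every a_j vanishes, so both sides are 0. *)
have E00 : E = 0.
  apply/le_anti; rewrite E0 andbT -(pmulr_rle0 _ al0).
  exact: le_trans hs s_le0.
rewrite E00 mulr0; apply: sumr_le0 => j _.
have sE : s = 0 by apply/le_anti; rewrite s_le0 s0.
by rewrite (psumr_eq0P _ sE) // subrr mulr0.
Qed.

(** * Almost every path loses all its energy *)

Section PathMeasure.
Variables (R : realType) (n : nat) (nu : probability (OmegaM n) R).
Variables (c e : seq 'I_n.+2 -> R) (rho : R).
Hypotheses (nuE : forall w, nu (cyl_set w) = (c w)%:E) (e_ge0 : forall w, 0 <= e w).
Hypotheses (rho_ge0 : 0 <= rho) (rho_lt1 : rho < 1).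
Hypothesis e_contr : forall w,
  \sum_j c (rcons w j) * e (rcons w j) <= rho * (c w * e w).
Hypothesis e_decr : forall w j, e (rcons w j) <= e w.

(** An arbitrary starting word w lets the induction on N split off the letter after w. As [e] is
    nonincreasing, exceeding t at the last depth means exceeding it all along the path. *)
Definition energetic_paths (t : R) (w : seq 'I_n.+2) (N : nat) : set (OmegaM n) :=
  [set om | cyl_set w om /\ t < e (wprefix om (size w + N))].

Lemma cyl_measurable w : measurable (cyl_set w : set (OmegaM n)).
Proof. by apply: sub_sigma_algebra; exists w. Qed.

Lemma cyl_mass_ge0 w : 0 <= c w.
Proof. by rewrite -lee_fin -nuE. Qed.

Lemma energetic_pathsS t w N : energetic_paths t w N.+1 =
  \big[setU/set0]_(j < n.+2) energetic_paths t (rcons w j) N.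
Proof.
rewrite -bigcup_mkord_ord; apply/seteqP; split => om.
  move=> [hw ht]; exists (nat_of_ord (om (size w))) => //=.
  rewrite inord_val; split; last by rewrite size_rcons addSnnS.
  by rewrite /cyl_set /= size_rcons wprefixS hw.
move=> [k _ [hw ht]]; split; last by rewrite size_rcons addSnnS in ht.
by move: hw; rewrite /cyl_set /= size_rcons wprefixS => /rcons_inj[].
Qed.

Lemma energetic_paths0 t w :
  energetic_paths t w 0 = if t < e w then cyl_set w else set0.
Proof.
apply/seteqP; split => om.
  by move=> [hw]; rewrite addn0 [wprefix _ _]hw => ->.
by case: ifP => // h hw; split => //; rewrite addn0 [wprefix _ _]hw.
Qed.

Lemma energetic_paths_measurable t w N : measurable (energetic_paths t w N).
Proof.
elim: N w => [|N IH] w.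
  by rewrite energetic_paths0; case: ifP => _ //; exact: cyl_measurable.
by rewrite energetic_pathsS; apply: bigsetU_measurable => j _; exact: IH.
Qed.

(** For N = 0 this is Markov's inequality on one cylinder. For N + 1 the set is a union over the
    words wj, and [e_contr] turns the sum of their bounds into one more factor rho. *)
Lemma energetic_paths_le t w N : 0 < t ->
  (nu (energetic_paths t w N) <= (rho ^+ N * (c w * e w) / t)%:E)%E.
Proof.
move=> t0; elim: N w => [|N IH] w.
  rewrite energetic_paths0 expr0 mul1r; case: ifP => ht.
    by rewrite nuE lee_fin ler_pdivlMr // ler_wpM2l ?cyl_mass_ge0 // ltW.
  by rewrite measure0 lee_fin divr_ge0 ?mulr_ge0 ?cyl_mass_ge0 // ltW.
rewrite energetic_pathsS.
(* [le_mu_bigsetU] takes sets indexed by nat, so letters pass through [inord]. *)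
have -> : \big[setU/set0]_(j < n.+2) energetic_paths t (rcons w j) N =
    \big[setU/set0]_(j < n.+2) energetic_paths t (rcons w (inord j)) N.
  by apply: eq_bigr => j _; rewrite inord_val.
apply: le_trans (le_mu_bigsetU nu (A := fun j => energetic_paths t (rcons w (inord j)) N) _) _.
  by move=> i _; exact: energetic_paths_measurable.
apply: (@le_trans _ _ (\sum_(j < n.+2) (rho ^+ N *
    (c (rcons w (inord j)) * e (rcons w (inord j))) / t)%:E)%E).
  by apply: lee_sum => j _; exact: IH.
rewrite sumEFin lee_fin -mulr_suml -mulr_sumr ler_pM2r ?invr_gt0 //.
under eq_bigr do rewrite inord_val.
rewrite exprSr -mulrA; apply: ler_wpM2l; first exact: exprn_ge0.
exact: e_contr.
Qed.

Lemma energetic_forever_null t : 0 < t ->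
  nu (\bigcap_N energetic_paths t [::] N) = 0%E.
Proof.
move=> t0; set A := \bigcap_N _.
have mA : measurable A by apply: bigcapT_measurable => N; exact: energetic_paths_measurable.
have fA : nu A \is a fin_num by exact: fin_num_measure.
have bound N : fine (nu A) <= geometric (c [::] * e [::] / t) rho N.
  rewrite -lee_fin fineK // /geometric /= mulrC mulrA.
  apply: le_trans (energetic_paths_le [::] N t0).
  apply: le_measure; rewrite ?inE //; first exact: energetic_paths_measurable.
  exact: bigcap_inf.
have cv : geometric (c [::] * e [::] / t) rho @ \oo --> (0 : R).
  by apply: cvg_geometric; rewrite ger0_norm.
apply/eqP; rewrite eq_le measure_ge0 andbT -(fineK fA) lee_fin.
rewrite -(cvg_lim _ cv) //; apply: limr_ge; first exact: cvgP cv.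
by near=> N; exact: bound.
Unshelve. all: by end_near. Qed.

(** Remove the null sets for the thresholds 1 / (k + 1). On every other path [e] falls to each
    threshold at some depth, and monotonicity keeps it there. *)
Lemma energy_vanishes_ae : exists Ox : set (OmegaM n),
  [/\ measurable Ox, nu Ox = 1%E &
    forall om, Ox om -> (fun N => e (wprefix om N)) @ \oo --> (0 : R)].
Proof.
pose F k := \bigcap_N energetic_paths k.+1%:R^-1 [::] N.
have mF k : measurable (F k).
  by apply: bigcapT_measurable => N; exact: energetic_paths_measurable.
have mU : measurable (\bigcup_k F k) by exact: bigcupT_measurable.
exists (~` (\bigcup_k F k)); split; first exact: measurableC.
  rewrite probability_setC // (_ : nu _ = 0%E) ?sube0 //.
  apply/negligibleP => //; apply: negligible_bigcup => k.
  by apply/negligibleP => //; apply: energetic_forever_null; rewrite invr_gt0.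
move=> om nF; apply/cvgrPdist_lt => eps eps0.
have [k hk] : exists k, k.+1%:R^-1 < eps.
  exists (Num.truncn eps^-1); rewrite invf_plt ?posrE //.
  exact: truncnS_gt.
have [N hN] : exists N, ~ energetic_paths k.+1%:R^-1 [::] N om.
  by apply/existsNP => h; apply: nF; exists k => // N _; exact: h.
have {}hN : e (wprefix om N) <= k.+1%:R^-1.
  by rewrite leNgt; apply/negP => h; apply: hN.
near=> M; rewrite sub0r normrN ger0_norm //.
apply: le_lt_trans hk; apply: le_trans hN.
have : (N <= M)%N by near: M; exact: nbhs_infty_ge.
move=> /subnKC <-; elim: (M - N)%N => [|i IH]; first by rewrite addn0.
by rewrite addnS wprefixS; apply: le_trans IH.
Unshelve. all: by end_near. Qed.

End PathMeasure.

(** * The spectral series of one increment *)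

Lemma cabs_cZ_sqr (R : realType) (a : R) (z : R[i]) :
  cabs_c (a%:C * z) ^+ 2 = a ^+ 2 * complex.Re (z^* * z).
Proof.
rewrite /cabs_c normc_def /= sqr_sqrtr ?addr_ge0 ?sqr_ge0 //.
by case: z => b d /=; ring.
Qed.

(** Pairing with x is continuous, and it turns the r-th term into lam |<x, u_r>|^2 = |<x, sqrt(lam)
    u_r>|^2. *)
Lemma spectral_series_cvg (R : realType) (H : lmodType R[i]) (ip : H -> H -> R[i])
    (I : set nat) (u : nat -> H) (lam : nat -> R) (x y : H) :
  inner_product_axioms ip -> (forall r, I r -> 0 <= lam r) ->
  hcvg ip (fun N => \sum_(0 <= r < N | r \in I) ((lam r)%:C * ip x (u r)) *: u r) y ->
  (fun N => \sum_(0 <= r < N | r \in I)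
      cabs_c (ip x ((Num.sqrt (lam r))%:C *: u r)) ^+ 2) @ \oo --> rip ip x y.
Proof.
move=> ipP lam0 /(hcvg_rip ipP) => /(_ x).
under eq_fun do rewrite (rip_sumr ipP).
suff -> : (fun N => \sum_(0 <= r < N | r \in I)
      cabs_c (ip x ((Num.sqrt (lam r))%:C *: u r)) ^+ 2) =
  (fun N => \sum_(0 <= r < N | r \in I)
      rip ip x (((lam r)%:C * ip x (u r)) *: u r)) by [].
apply/funext => N; apply: eq_bigr => r /set_mem /lam0 l0.
rewrite (ipZr ipP) [X in cabs_c (X * _)]conjc_real cabs_cZ_sqr sqr_sqrtr // /rip (ipZr ipP).
by case: (ip x (u r)) => a b /=; ring.
Qed.

Theorem theorem6p2 (R : realType) (H : lmodType R[i]) (ip : H -> H -> R[i])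
  (n : nat) (P : 'I_n.+2 -> H -> H) (R0 : H -> H) (q : 'I_n.+2 -> R) (x : H)
  (nu : probability (OmegaM n) R)
  (Rk : Omega n -> nat -> set nat) (u : Omega n -> nat -> nat -> H)
  (lam : Omega n -> nat -> nat -> R) :
  separable_hilbert ip ->
  (forall j, orth_proj ip (P j)) ->
  positive_op ip R0 ->
  leakage ip P R0 ->
  trace_class_pos ip R0 ->
  (forall j, 0 <= q j) -> \sum_(j < n.+2) q j = 1 ->
  (* nu = nu_x : the path measure with the energy-biased cyl_set probabilities *)
  (forall w : seq 'I_n.+2, nu (cyl_set w) = (cylprob ip P R0 x q w)%:E) ->
  0 < ip x (R0 x) ->
  (* spectral decompositions of Delta_k(omega), k >= 1 (SOT convergence) *)
  (forall (om : Omega n) (k : nat), (1 <= k)%N ->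
     [/\ ortho_family ip (Rk om k) (u om k),
         (forall r, Rk om k r -> 0 <= lam om k r) &
         (forall v : H, hcvg ip
            (fun N => \sum_(0 <= r < N | r \in Rk om k)
                        (real_complex R (lam om k r) * ip v (u om k r)) *: u om k r)
            (DeltaOp ip P R0 om k v))]) ->
  let phi := fun (om : Omega n) (k r : nat) =>
               real_complex R (Num.sqrt (lam om k r)) *: u om k r in
  exists Ox : set (OmegaM n),
    [/\ measurable Ox, nu Ox = 1%E &
      forall om : Omega n, Ox om ->
        [/\ (* <x,R0x> = sum_{k>=1} A_k(omega), monotone convergence *)
            (fun N => \sum_(1 <= k < N) Ak ip P R0 x om k) @ \oo
               --> complex.Re (ip x (R0 x)),
            nondecreasing_seq (fun N => \sum_(1 <= k < N) Ak ip P R0 x om k),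
            (* each inner series sum_{r in R_k} |<x,phi_{k,r}>|^2 converges *)
            (forall k, (1 <= k)%N ->
               cvgn (fun M => \sum_(0 <= r < M | r \in Rk om k)
                                cabs_c (ip x (phi om k r)) ^+ 2)),
            (* <x,R0x> = sum_k sum_r |<x,phi_{k,r}>|^2, monotonically *)
            (fun N => \sum_(1 <= k < N)
                 limn (fun M => \sum_(0 <= r < M | r \in Rk om k)
                                  cabs_c (ip x (phi om k r)) ^+ 2)) @ \oo
               --> complex.Re (ip x (R0 x)) &
            nondecreasing_seq (fun N => \sum_(1 <= k < N)
                 limn (fun M => \sum_(0 <= r < M | r \in Rk om k)
                                  cabs_c (ip x (phi om k r)) ^+ 2))]].
Proof.
move=> [ipP hc _] projP posR0 leak _ _ _ nuE _ spec phi.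
have [alpha a0 leakE] := leakage_energy x ipP hc projP posR0 leak.
pose e := energy ip P R0 x; pose c := cylprob ip P R0 x q.
(* The maximum with 0 supplies [rho_ge0] without a proof that alpha <= n + 2. *)
pose rho : R := Num.max 0 (1 - alpha / n.+2%:R).
have e0 : forall w, 0 <= e w by exact: energy_ge0.
have aw0 : forall w j, 0 <= aw ip P R0 x w j by exact: aw_ge0.
have eS : forall w j, e (rcons w j) = e w - aw ip P R0 x w j by exact: energy_rcons.
have c0 w : 0 <= c w by rewrite -lee_fin -nuE.
have rho0 : 0 <= rho by rewrite le_max lexx.
have rho1 : rho < 1 by rewrite gt_max ltr01 ltrBlDr ltrDl divr_gt0.
have contr w : \sum_j c (rcons w j) * e (rcons w j) <= rho * (c w * e w).
  (* The factor [c w] comes out because c (wj) = c w * p_x(j | w). *)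
  rewrite mulrCA (_ : \sum_j _ = c w * \sum_j px ip P R0 x q w j * (e w - aw ip P R0 x w j)).
    apply: ler_wpM2l => //; apply: le_trans (biased_contraction _ _ _ a0 (leakE w)) _ => //.
    by rewrite ler_wpM2r // le_max lexx orbT.
  rewrite mulr_sumr; apply: eq_bigr => j _.
  by rewrite eS mulrA /c /cylprob rev_rcons /= revK.
have decr w j : e (rcons w j) <= e w by rewrite eS gerBl.
have [Ox [mOx nuOx cvOx]] := energy_vanishes_ae nuE e0 rho0 rho1 contr decr.
exists Ox; split => // om Oom.
have inner k : (1 <= k)%N -> (fun M => \sum_(0 <= r < M | r \in Rk om k)
    cabs_c (ip x (phi om k r)) ^+ 2) @ \oo --> Ak ip P R0 x om k.
  by move=> /(spec om)[_ l0 /(_ x)]; exact: spectral_series_cvg.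
have outer : (fun N => \sum_(1 <= k < N) limn (fun M => \sum_(0 <= r < M | r \in Rk om k)
    cabs_c (ip x (phi om k r)) ^+ 2)) = (fun N => \sum_(1 <= k < N) Ak ip P R0 x om k).
  apply/funext => N; rewrite !big_nat; apply: eq_bigr => k /andP[k1 _].
  by apply/cvg_lim => //; exact: inner.
have cvA : (fun N => \sum_(1 <= k < N) Ak ip P R0 x om k) @ \oo --> complex.Re (ip x (R0 x)).
  (* The shift turns [N.-1] in [sum_Ak] into N, leaving e_0 minus the vanishing energy of the N-th
     prefix. *)
  rewrite -(cvg_shiftS (fun N => \sum_(1 <= k < N) Ak ip P R0 x om k)).
  under eq_fun do rewrite (sum_Ak x ipP hc projP posR0).
  rewrite -[complex.Re _]subr0.
  by apply: cvgB; [exact: cvg_cst|exact: cvOx].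
have ndA : nondecreasing_seq (fun N => \sum_(1 <= k < N) Ak ip P R0 x om k).
  (* Since k starts at 1, the sums for N = 0 and N = 1 are both empty. *)
  apply/nondecreasing_seqP => -[|N]; first by rewrite !big_geq.
  by rewrite [leRHS]big_nat_recr //= lerDl; exact: aw0.
split; rewrite ?outer // => k k1.
exact: cvgP (inner k k1).
Qed.
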